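(* Let $\alpha,\beta,\gamma\in\mathbb{C}$ and $x,y\in\mathbb{C}$ with $|x|<1$, $|y|<1$. (i) If $q^\gamma\notin\{1,q^{-1},q^{-2},\dots\}$, then $$[\mathbf{\Theta}_{x,q}]_{q}\mathbf{\Phi}_{1}(q^\alpha,q^\beta;q^\gamma;q,x,y)=\frac{[\alpha]_{q}[\beta]_{q}}{[\gamma]_{q}}\,x\,\mathbf{\Phi}_{1}(q^{\alpha+1},q^{\beta+1};q^{\gamma+1};q,x,y),$$ $$[\mathbf{\Theta}_{y,q}]_{q}\mathbf{\Phi}_{1}(q^\alpha,q^\beta;q^\gamma;q,x,y)=\frac{[\alpha]_{q}}{(1-q)[\gamma]_{q}}\,y\,\mathbf{\Phi}_{1}(q^{\alpha+1},q^{\beta};q^{\gamma+1};q,x,y),$$ $$[\mathbf{\Theta}_{x,q}]_{q}\mathbf{\Phi}_{2}(q^\alpha,q^\beta;q^\gamma;q,x,y)=\frac{[\alpha]_{q}}{(1-q)[\gamma]_{q}}\,x\,\mathbf{\Phi}_{2}(q^{\alpha+1},q^\beta;q^{\gamma+1};q,x,y),$$ $$[\mathbf{\Theta}_{y,q}]_{q}\mathbf{\Phi}_{2}(q^\alpha,q^\beta;q^\gamma;q,x,y)=\frac{[\beta]_{q}}{(1-q)[\gamma]_{q}}\,y\,\mathbf{\Phi}_{2}(q^\alpha,q^{\beta+1};q^{\gamma+1};q,x,y).$$ (ii) If $q^\beta\notin\{1,q^{-1},q^{-2},\dots\}$, then $$[\mathbf{\Theta}_{x,q}]_{q}\mathbf{\Phi}_{3}(q^\alpha;q^\beta;q,x,y)=\frac{[\alpha]_{q}}{(1-q)[\beta]_{q}}\,x\,\mathbf{\Phi}_{3}(q^{\alpha+1};q^{\beta+1};q,x,y),$$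 $$[\mathbf{\Theta}_{y,q}]_{q}\mathbf{\Phi}_{3}(q^\alpha;q^\beta;q,x,y)=\frac{1}{(1-q)^{2}[\beta]_{q}}\,y\,\mathbf{\Phi}_{3}(q^\alpha;q^{\beta+1};q,x,y).$$
   Context: Fix $q\in\mathbb{C}$ with $0<|q|<1$ and a choice of $\log q$, so that $q^{z}=e^{z\log q}$ for $z\in\mathbb{C}$. Put $[z]_q=\frac{1-q^z}{1-q}$. The $q$-shifted factorial is $(a;q)_0=1$, $(a;q)_\ell=\prod_{j=0}^{\ell-1}(1-aq^j)$ for $\ell\ge 1$. The basic Humbert functions are, for $|x|<1,|y|<1$, $$\mathbf{\Phi}_{1}(q^{\alpha},q^{\beta};q^{\gamma};q,x,y)=\sum_{n,k=0}^{\infty}\frac{(q^{\alpha};q)_{n+k}(q^{\beta};q)_{n}}{(q^{\gamma};q)_{n+k}(q;q)_{n}(q;q)_{k}}x^{n}y^{k},$$ $$\mathbf{\Phi}_{2}(q^{\alpha},q^{\beta};q^{\gamma};q,x,y)=\sum_{n,k=0}^{\infty}\frac{(q^{\alpha};q)_{n}(q^{\beta};q)_{k}}{(q^{\gamma};q)_{n+k}(q;q)_{n}(q;q)_{k}}x^{n}y^{k},$$ $$\mathbf{\Phi}_{3}(q^{\alpha};q^{\beta};q,x,y)=\sum_{n,k=0}^{\infty}\frac{(q^{\alpha};q)_{n}}{(q^{\beta};q)_{n+k}(q;q)_{n}(q;q)_{k}}x^{n}y^{k},$$ defined when the denominator parameter ($q^\gamma$ for $\mathbf\Phi_1,\mathbf\Phi_2$;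 $q^\beta$ for $\mathbf\Phi_3$) is not in $\{1,q^{-1},q^{-2},\dots\}$. The operators $q^{\mathbf{\Theta}_{x,q}}$ and $q^{\mathbf{\Theta}_{y,q}}$ are by convention the dilations $f(x,y)\mapsto f(qx,y)$ and $f(x,y)\mapsto f(x,qy)$, and $[\mathbf{\Theta}_{x,q}]_q=\frac{1-q^{\mathbf{\Theta}_{x,q}}}{1-q}$, $[\mathbf{\Theta}_{y,q}]_q=\frac{1-q^{\mathbf{\Theta}_{y,q}}}{1-q}$; thus $[\mathbf{\Theta}_{x,q}]_q$ multiplies $x^ny^k$ by $[n]_q$ and $[\mathbf{\Theta}_{y,q}]_q$ multiplies it by $[k]_q$. *)

(* Defs.v *)
From Stdlib Require Import Reals.
From Coquelicot Require Import Coquelicot.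

Local Open Scope C_scope.

(** Complex exponential: [e^(a + i b) = e^a (cos b + i sin b)]. *)
Definition Cexp (z : C) : C :=
  RtoC (exp (Re z)) * (cos (Im z), sin (Im z))%R.

(** [q^z], where [lq] is the chosen logarithm of [q]. *)
Definition qpow (lq z : C) : C := Cexp (z * lq).

(** [[z]_q]; it depends on [q] and on the choice [lq] of its logarithm. *)
Definition qnum (q lq z : C) : C := (1 - qpow lq z) / (1 - q).

(** [(a; q)_l = (1 - a) (1 - a q) ... (1 - a q^(l-1))]. *)
Fixpoint qpoch (a q : C) (l : nat) : C :=
  match l with
  | O => 1
  | S j => qpoch a q j * (1 - a * q ^ j)
  end.

(** Rectangular partial sums: both indices run from [0], bounds included. *)
Definition rect_sum (a : nat -> nat -> C) (NK : nat * nat) : C :=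
  sum_n (fun n => sum_n (fun k => a n k) (snd NK)) (fst NK).

Definition is_double_series (a : nat -> nat -> C) (s : C) : Prop :=
  filterlim (rect_sum a) (filter_prod eventually eventually) (locally s).

(** The sum of a double series, as the limit of the rectangular partial sums
    when both bounds tend independently to infinity; like [RInt] or [Series],
    it has an unspecified value when that limit does not exist. *)
Definition DoubleSeries (a : nat -> nat -> C) : C :=
  iota (T := C_CompleteNormedModule) (is_double_series a).

(** The basic Humbert functions. As in the notation
    [Phi_1(q^alpha, q^beta; q^gamma; q, x, y)], the parameters [a], [b], [c]
    are the powers of [q] themselves, not the exponents. *)
Definition Phi1 (a b c q x y : C) : C :=
  DoubleSeries (fun n k =>
    (qpoch a q (n + k) * qpoch b q n)
      / (qpoch c q (n + k) * qpoch q q n * qpoch q q k) * x ^ n * y ^ k).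

Definition Phi2 (a b c q x y : C) : C :=
  DoubleSeries (fun n k =>
    (qpoch a q n * qpoch b q k)
      / (qpoch c q (n + k) * qpoch q q n * qpoch q q k) * x ^ n * y ^ k).

Definition Phi3 (a b q x y : C) : C :=
  DoubleSeries (fun n k =>
    qpoch a q n
      / (qpoch b q (n + k) * qpoch q q n * qpoch q q k) * x ^ n * y ^ k).

(** The dilations [q^Theta_x] and [q^Theta_y]. *)
Definition qTheta_x (q : C) (f : C -> C -> C) : C -> C -> C :=
  fun x y => f (q * x) y.

Definition qTheta_y (q : C) (f : C -> C -> C) : C -> C -> C :=
  fun x y => f x (q * y).

(** The operators [[Theta_x]_q = (1 - q^Theta_x) / (1 - q)] and
    [[Theta_y]_q]. *)
Definition Theta_x (q : C) (f : C -> C -> C) : C -> C -> C :=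
  fun x y => (f x y - qTheta_x q f x y) / (1 - q).

Definition Theta_y (q : C) (f : C -> C -> C) : C -> C -> C :=
  fun x y => (f x y - qTheta_y q f x y) / (1 - q).

(** [c] is not in [{1, q^(-1), q^(-2), ...}]. *)
Definition admissible (q c : C) : Prop := forall m : nat, c <> / q ^ m.

(* Main.v *)
(** The operators [[Theta_x]_q] and [[Theta_y]_q] act termwise on a double power
    series, killing the terms of index 0, and
    [(a; q)_(n+1) = (1 - a) (a q; q)_n] turns the surviving coefficients into
    those of the contiguous function after one index is shifted. The termwise
    action needs convergence on the unit bidisc: both [(a; q)_n] and
    [1 / (c; q)_n] stay bounded because their successive ratios are
    [1 + O(|q|^n)], so the terms are dominated by [M |x|^n |y|^k]. *)
Require Import Defs.
From Stdlib Require Import Reals Lra Lia.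
From Coquelicot Require Import Coquelicot.

Local Open Scope C_scope.

(** * Limits of rectangular partial sums: uniqueness, transposition, linearity, index shift *)

Lemma is_double_series_unique (a : nat -> nat -> C) (s : C) :
  is_double_series a s -> DoubleSeries a = s.
Proof.
  intros H.
  exact (iota_filterlim_locally (V := C_CompleteNormedModule)
           (rect_sum a) s H).
Qed.

Lemma is_double_series_ext (a b : nat -> nat -> C) (s : C) :
  (forall n k, a n k = b n k) -> is_double_series a s -> is_double_series b s.
Proof.
  intros E. apply filterlim_ext. intros [N K]. unfold rect_sum; simpl.
  apply sum_n_ext; intros n. apply sum_n_ext; intros k. apply E.
Qed.

(** The two bounds tend to infinity independently, so they can trade places, and finite sums
    commute. This lets results in [x] be carried over to [y]. *)
Lemma is_double_series_transpose (a : nat -> nat -> C) (s : C) :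
  is_double_series a s -> is_double_series (fun n k => a k n) s.
Proof.
  intros H P HP. destruct (H P HP) as [Q1 Q2 H1 H2 HQ].
  apply (Filter_prod _ _ _ Q2 Q1 H2 H1). intros N K HN HK.
  unfold rect_sum; simpl.
  rewrite (sum_n_switch (fun n k => a k n)).
  exact (HQ K N HK HN).
Qed.

Lemma rect_sum_scal (l : C) (a : nat -> nat -> C) (NK : nat * nat) :
  rect_sum (fun n k => l * a n k) NK = l * rect_sum a NK.
Proof.
  unfold rect_sum.
  rewrite (sum_n_ext _ (fun n => l * sum_n (a n) (snd NK)))
    by (intros n; apply (sum_n_mult_l (K := C_Ring))).
  apply (sum_n_mult_l (K := C_Ring)).
Qed.

Lemma rect_sum_plus (a b : nat -> nat -> C) (NK : nat * nat) :
  rect_sum (fun n k => a n k + b n k) NK = rect_sum a NK + rect_sum b NK.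
Proof.
  unfold rect_sum.
  rewrite (sum_n_ext _ (fun n => sum_n (a n) (snd NK) + sum_n (b n) (snd NK)))
    by (intros n; apply (sum_n_plus (G := C_AbelianMonoid))).
  apply (sum_n_plus (G := C_AbelianMonoid)).
Qed.

Lemma is_double_series_scal (l : C) (a : nat -> nat -> C) (s : C) :
  is_double_series a s -> is_double_series (fun n k => l * a n k) (l * s).
Proof.
  intros Ha.
  apply filterlim_ext with (fun NK => l * rect_sum a NK).
  { intros NK. symmetry. apply rect_sum_scal. }
  eapply filterlim_comp;
    [exact Ha | apply (filterlim_scal_r (V := C_NormedModule))].
Qed.

Lemma is_double_series_minus (a b : nat -> nat -> C) (s t : C) :
  is_double_series a s -> is_double_series b t ->
  is_double_series (fun n k => a n k - b n k) (s - t).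
Proof.
  intros Ha Hb.
  apply is_double_series_ext with (fun n k => a n k + -(1) * b n k);
    [intros n k; ring |].
  replace (s - t) with (s + -(1) * t) by ring.
  apply filterlim_ext with
    (fun NK => rect_sum a NK + rect_sum (fun n k => -(1) * b n k) NK).
  { intros NK. symmetry. apply rect_sum_plus. }
  eapply filterlim_comp_2;
    [exact Ha | | apply (filterlim_plus (V := C_NormedModule))].
  apply is_double_series_scal, Hb.
Qed.

Lemma sum_n_shift (u : nat -> C) (N : nat) :
  u O = 0 -> sum_n u (S N) = sum_n (fun n => u (S n)) N.
Proof.
  intros H. induction N as [|N IH].
  - rewrite sum_Sn, !sum_O, H. apply (plus_zero_l (G := C_AbelianMonoid)).
  - now rewrite sum_Sn, IH, sum_Sn.
Qed.

(** With a zero row at [n = 0], the [(N, K)] rectangle of the shifted family has the same sum as the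
    [(S N, K)] rectangle of [a], and [S N] tends to infinity with [N]. *)
Lemma is_double_series_shift (a : nat -> nat -> C) (s : C) :
  (forall k, a O k = 0) -> is_double_series a s ->
  is_double_series (fun n k => a (S n) k) s.
Proof.
  intros H0 H P HP. destruct (H P HP) as [Q1 Q2 [N1 H1] H2 HQ].
  apply (Filter_prod _ _ _ (fun N => (N1 <= N)%nat) Q2);
    [now exists N1 | exact H2 |].
  intros N K HN HK. specialize (HQ (S N) K (H1 (S N) ltac:(lia)) HK).
  replace (rect_sum (fun n k => a (S n) k) (N, K))
    with (rect_sum a (S N, K)); [exact HQ |].
  unfold rect_sum; simpl.
  apply (sum_n_shift (fun n => sum_n (fun k => a n k) K)).
  rewrite (sum_n_ext _ (fun _ => zero)) by exact H0.
  apply (sum_n_m_const_zero (G := C_AbelianMonoid)).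
Qed.

(** * Convergence of double series dominated by a product of two series *)

Lemma Cmod_sum_n_le (u : nat -> C) (v : nat -> R) (N : nat) :
  (forall n, Cmod (u n) <= v n)%R -> (Cmod (sum_n u N) <= sum_n v N)%R.
Proof.
  intros H. induction N as [|N IH].
  - rewrite !sum_O. apply H.
  - rewrite !sum_Sn. eapply Rle_trans; [apply Cmod_triangle |].
    apply Rplus_le_compat; [exact IH | apply H].
Qed.

(** The right-hand side is the sum of the majorant [f n * g k] over the cells of the large rectangle
    outside the small one. The induction first raises [K] to [K'] with [N] fixed, then adds full
    rows up to [N']. *)
Lemma rect_sum_increment_le (a : nat -> nat -> C) (f g : nat -> R)
    (N N' K K' : nat) :
  (forall n k, Cmod (a n k) <= f n * g k)%R ->
  (N <= N')%nat -> (K <= K')%nat ->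
  (Cmod (rect_sum a (N', K') - rect_sum a (N, K))
    <= sum_n f N' * sum_n g K' - sum_n f N * sum_n g K)%R.
Proof.
  intros H HN HK. induction HN as [|N' HN IHN].
  - induction HK as [|K' HK IHK].
    + replace (rect_sum a (N, K) - rect_sum a (N, K)) with (RtoC 0) by ring.
      rewrite Cmod_0. lra.
    + replace (rect_sum a (N, S K')) with
        (rect_sum a (N, K') + sum_n (fun n => a n (S K')) N).
      2:{ unfold rect_sum; simpl.
          change Cplus with (@plus C_AbelianMonoid).
          rewrite <- sum_n_plus.
          apply sum_n_ext; intros n. now rewrite sum_Sn. }
      rewrite sum_Sn.
      assert (E : (Cmod (sum_n (fun n => a n (S K')) N)
                    <= sum_n f N * g (S K'))%R).
      { eapply Rle_trans.
        - apply (Cmod_sum_n_le _ (fun n => f n * g (S K'))%R).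
          intros n; apply H.
        - apply Req_le, (sum_n_mult_r (K := R_Ring)). }
      replace (rect_sum a (N, K') + sum_n (fun n => a n (S K')) N
                 - rect_sum a (N, K))
        with ((rect_sum a (N, K') - rect_sum a (N, K))
                 + sum_n (fun n => a n (S K')) N) by ring.
      eapply Rle_trans; [apply Cmod_triangle |].
      change plus with Rplus. lra.
  - replace (rect_sum a (S N', K')) with
      (rect_sum a (N', K') + sum_n (a (S N')) K').
    2:{ unfold rect_sum; simpl. now rewrite sum_Sn. }
    rewrite sum_Sn.
    assert (E : (Cmod (sum_n (a (S N')) K') <= f (S N') * sum_n g K')%R).
    { eapply Rle_trans.
      - apply (Cmod_sum_n_le _ (fun k => f (S N') * g k)%R).
        intros k; apply H.
      - apply Req_le, (sum_n_mult_l (K := R_Ring)). }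
    replace (rect_sum a (N', K') + sum_n (a (S N')) K' - rect_sum a (N, K))
      with ((rect_sum a (N', K') - rect_sum a (N, K))
               + sum_n (a (S N')) K') by ring.
    eapply Rle_trans; [apply Cmod_triangle |].
    change plus with Rplus. lra.
Qed.

(** Cauchy criterion: the products of partial sums of [f] and [g] converge, and their increments
    control those of [rect_sum a]. *)
Lemma ex_double_series_dominated (a : nat -> nat -> C) (f g : nat -> R) :
  (forall n k, Cmod (a n k) <= f n * g k)%R ->
  ex_series f -> ex_series g ->
  exists s, is_double_series a s.
Proof.
  intros H [F HF] [G HG]. simpl in F, G.
  apply (proj1 (filterlim_locally_cauchy (U := C_CompleteNormedModule)
                  (F := filter_prod eventually eventually) (rect_sum a))).
  intros eps.
  assert (L : filterlim (fun NK => sum_n f (fst NK) * sum_n g (snd NK))%R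
                (filter_prod eventually eventually) (locally (F * G)%R)).
  { eapply filterlim_comp_2; [| | apply (filterlim_mult (K := R_AbsRing))].
    - eapply filterlim_comp; [apply filterlim_fst | exact HF].
    - eapply filterlim_comp; [apply filterlim_snd | exact HG]. }
  (* Two products within [eps / 4] of [F * G] differ by less than [eps / 2]; a triangle inequality
     through the reference rectangle then costs [eps]. *)
  assert (e4 : (0 < eps / 4)%R) by (destruct eps; simpl; lra).
  destruct (proj1 (filterlim_locally _ _) L (mkposreal _ e4))
    as [Q1 Q2 [N0 H1] [K0 H2] HQ].
  (* Two arbitrary large rectangles need not be nested, so each is compared with the rectangle
     [(N0, K0)] contained in both. *)
  assert (D : forall N K, (N0 <= N)%nat -> (K0 <= K)%nat ->
     (Cmod (rect_sum a (N, K) - rect_sum a (N0, K0)) < eps / 2)%R).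
  { intros N K HN HK.
    eapply Rle_lt_trans; [now apply rect_sum_increment_le with (1 := H) |].
    generalize (HQ N K (H1 N HN) (H2 K HK))
      (HQ N0 K0 (H1 N0 (le_n _)) (H2 K0 (le_n _))).
    unfold ball; simpl. unfold AbsRing_ball, abs, minus, plus, opp, mult; simpl.
    intros B1 B2. apply Rabs_def2 in B1, B2. lra. }
  exists (fun NK => (N0 <= fst NK)%nat /\ (K0 <= snd NK)%nat). split.
  - apply (Filter_prod _ _ _ (fun N => (N0 <= N)%nat) (fun K => (K0 <= K)%nat));
      [now exists N0 | now exists K0 | now split].
  - intros [N K] [N' K'] [HN HK] [HN' HK']; simpl in *.
    apply (norm_compat1 (V := C_NormedModule)).
    change (Cmod (rect_sum a (N', K') - rect_sum a (N, K)) < eps)%R.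
    replace (rect_sum a (N', K') - rect_sum a (N, K)) with
      ((rect_sum a (N', K') - rect_sum a (N0, K0))
         + - (rect_sum a (N, K) - rect_sum a (N0, K0))) by ring.
    eapply Rle_lt_trans; [apply Cmod_triangle |]. rewrite Cmod_opp.
    specialize (D N K HN HK) as D1. specialize (D N' K' HN' HK') as D2. lra.
Qed.

(** * Double power series with bounded coefficients, and the operators acting on them *)

Definition bounded_coef (A : nat -> nat -> C) : Prop :=
  exists M : R, forall n k, (Cmod (A n k) <= M)%R.

Lemma bounded_coef_mult (A B : nat -> nat -> C) :
  bounded_coef A -> bounded_coef B -> bounded_coef (fun n k => A n k * B n k).
Proof.
  intros [M HM] [M' HM']. exists (M * M')%R. intros n k. rewrite Cmod_mult.
  apply Rmult_le_compat; auto using Cmod_ge_0.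
Qed.

Lemma ex_double_power_series (A : nat -> nat -> C) (x y : C) :
  bounded_coef A -> (Cmod x < 1)%R -> (Cmod y < 1)%R ->
  exists s, is_double_series (fun n k => A n k * x ^ n * y ^ k) s.
Proof.
  intros [M HM] hx hy.
  apply ex_double_series_dominated with
    (fun n => M * Cmod x ^ n)%R (fun k => Cmod y ^ k)%R.
  - intros n k. rewrite !Cmod_mult, !Cmod_pow.
    apply Rmult_le_compat_r; [apply pow_le, Cmod_ge_0 |].
    apply Rmult_le_compat_r; [apply pow_le, Cmod_ge_0 | apply HM].
  - apply (ex_series_scal_l (V := R_NormedModule) M), ex_series_geom.
    rewrite Rabs_pos_eq; [exact hx | apply Cmod_ge_0].
  - apply ex_series_geom. rewrite Rabs_pos_eq; [exact hy | apply Cmod_ge_0].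
Qed.

Lemma one_minus_neq0 (z : C) : z <> 1 -> 1 - z <> 0.
Proof. intros H E. apply H. replace z with (1 - (1 - z)) by ring. rewrite E. ring. Qed.

Lemma Cmod_lt1_neq1 (z : C) : (Cmod z < 1)%R -> z <> 1.
Proof. intros H E. rewrite E, Cmod_1 in H. lra. Qed.

Lemma Cmod_dilation_lt1 (q x : C) :
  (Cmod q < 1)%R -> (Cmod x < 1)%R -> (Cmod (q * x) < 1)%R.
Proof.
  intros hq hx. rewrite Cmod_mult.
  assert (H := Cmod_ge_0 q). assert (H' := Cmod_ge_0 x). nra.
Qed.

(** The difference has general term [A n k * (1 - q ^ n) * x ^ n * y ^ k]. Replacing [n] by [S n]
    gives the factor [1 - q * q ^ n] of the hypothesis and frees one factor [x]. *)
Lemma is_double_series_dilation_minus (q : C) (A B : nat -> nat -> C)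
    (l x y s s' t : C) :
  (forall n k, A (S n) k * (1 - q * q ^ n) = l * B n k) ->
  is_double_series (fun n k => A n k * x ^ n * y ^ k) s ->
  is_double_series (fun n k => A n k * (q * x) ^ n * y ^ k) s' ->
  is_double_series (fun n k => B n k * x ^ n * y ^ k) t ->
  s - s' = l * x * t.
Proof.
  intros E Hs Hs' Ht.
  assert (H := is_double_series_minus _ _ _ _ Hs Hs').
  (* The row [n = 0] does not involve [x], so the dilation leaves it fixed and the difference
     vanishes there. *)
  apply is_double_series_shift in H; [| intros k; simpl; ring].
  rewrite <- (is_double_series_unique _ _ H).
  apply is_double_series_unique.
  apply is_double_series_ext with (2 := is_double_series_scal (l * x) _ _ Ht).
  intros n k. rewrite Cpow_mult_l, !Cpow_S.
  replace (l * x * (B n k * x ^ n * y ^ k))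
    with ((l * B n k) * x * x ^ n * y ^ k) by ring.
  rewrite <- E. ring.
Qed.

(** The factor [1 - q] in the coefficient relation cancels the denominator of the operator. Besides
    convergence at [x], convergence at [q * x] is needed, which stays in the unit disc. *)
Lemma Theta_x_double_power_series (q : C) (A B : nat -> nat -> C) (l x y : C) :
  (Cmod q < 1)%R -> (Cmod x < 1)%R -> (Cmod y < 1)%R ->
  bounded_coef A -> bounded_coef B ->
  (forall n k, A (S n) k * (1 - q * q ^ n) = (1 - q) * l * B n k) ->
  Theta_x q (fun x y => DoubleSeries (fun n k => A n k * x ^ n * y ^ k)) x y
    = l * x * DoubleSeries (fun n k => B n k * x ^ n * y ^ k).
Proof.
  intros hq hx hy HA HB E.
  destruct (ex_double_power_series A x y HA hx hy) as [s Hs].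
  destruct (ex_double_power_series A (q * x) y HA
              (Cmod_dilation_lt1 _ _ hq hx) hy) as [s' Hs'].
  destruct (ex_double_power_series B x y HB hx hy) as [t Ht].
  unfold Theta_x, qTheta_x.
  rewrite (is_double_series_unique _ _ Hs), (is_double_series_unique _ _ Hs'),
    (is_double_series_unique _ _ Ht).
  rewrite (is_double_series_dilation_minus q A B _ x y s s' t E Hs Hs' Ht).
  field. apply one_minus_neq0, Cmod_lt1_neq1, hq.
Qed.

Lemma Theta_y_double_power_series (q : C) (A B : nat -> nat -> C) (l x y : C) :
  (Cmod q < 1)%R -> (Cmod x < 1)%R -> (Cmod y < 1)%R ->
  bounded_coef A -> bounded_coef B ->
  (forall n k, A n (S k) * (1 - q * q ^ k) = (1 - q) * l * B n k) ->
  Theta_y q (fun x y => DoubleSeries (fun n k => A n k * x ^ n * y ^ k)) x y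
    = l * y * DoubleSeries (fun n k => B n k * x ^ n * y ^ k).
Proof.
  intros hq hx hy HA HB E.
  destruct (ex_double_power_series A x y HA hx hy) as [s Hs].
  destruct (ex_double_power_series A x (q * y) HA hx
              (Cmod_dilation_lt1 _ _ hq hy)) as [s' Hs'].
  destruct (ex_double_power_series B x y HB hx hy) as [t Ht].
  unfold Theta_y, qTheta_y.
  rewrite (is_double_series_unique _ _ Hs), (is_double_series_unique _ _ Hs'),
    (is_double_series_unique _ _ Ht).
  (* Exchanging both the indices and the variables turns the dilation in [y] into one in the first
     variable. *)
  assert (T : forall D u v w,
    is_double_series (fun n k => D n k * u ^ n * v ^ k) w ->
    is_double_series (fun n k => D k n * v ^ n * u ^ k) w).
  { intros D u v w Hw. apply is_double_series_transpose in Hw.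
    apply is_double_series_ext with (2 := Hw). intros n k; ring. }
  rewrite (is_double_series_dilation_minus q (fun n k => A k n)
             (fun n k => B k n) ((1 - q) * l) y x s s' t);
    [| intros n k; apply E | apply T, Hs | apply T, Hs' | apply T, Ht].
  field. apply one_minus_neq0, Cmod_lt1_neq1, hq.
Qed.

(** * Boundedness of q-shifted factorials and of their reciprocals *)

Lemma bounded_product (u w : nat -> C) (K r : R) :
  (0 <= K)%R -> (0 <= r < 1)%R -> u O = 1 ->
  (forall j, u (S j) = u j * w j) ->
  (forall j, Cmod (w j) <= 1 + K * r ^ j)%R ->
  exists M : R, forall n, (Cmod (u n) <= M)%R.
Proof.
  intros HK Hr H0 HS Hw. exists (exp (K / (1 - r))).
  (* The exponent is the geometric sum of [K * r ^ j] over [j < n]: each factor is at most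
     [1 + K * r ^ j], hence at most [exp (K * r ^ j)]. The full geometric series gives the uniform
     bound. *)
  assert (B : forall n, (Cmod (u n) <= exp (K * (1 - r ^ n) / (1 - r)))%R).
  { induction n as [|n IH].
    - rewrite H0, Cmod_1. simpl.
      replace (K * (1 - 1) / (1 - r))%R with 0%R by (field; lra).
      rewrite exp_0. lra.
    - rewrite HS, Cmod_mult.
      replace (K * (1 - r ^ S n) / (1 - r))%R
        with (K * (1 - r ^ n) / (1 - r) + K * r ^ n)%R by (simpl; field; lra).
      rewrite exp_plus. apply Rmult_le_compat; auto using Cmod_ge_0.
      eapply Rle_trans; [apply Hw | apply exp_ineq1_le]. }
  intros n. eapply Rle_trans; [apply B |].
  assert (P : (0 <= K * r ^ n / (1 - r))%R).
  { apply Rmult_le_pos; [apply Rmult_le_pos; [exact HK | apply pow_le; lra] |].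
    apply Rlt_le, Rinv_0_lt_compat. lra. }
  assert (D : (K * (1 - r ^ n) / (1 - r) <= K / (1 - r))%R).
  { replace (K / (1 - r))%R
      with (K * (1 - r ^ n) / (1 - r) + K * r ^ n / (1 - r))%R by (field; lra).
    lra. }
  destruct D as [D | D]; [left; now apply exp_increasing | rewrite D; lra].
Qed.

Lemma qpoch_bounded (a q : C) :
  (Cmod q < 1)%R -> exists M : R, forall n, (Cmod (qpoch a q n) <= M)%R.
Proof.
  intros hq.
  apply bounded_product with (fun j => 1 - a * q ^ j) (Cmod a) (Cmod q);
    auto using Cmod_ge_0.
  intros j. unfold Cminus. eapply Rle_trans; [apply Cmod_triangle |].
  rewrite Cmod_opp, Cmod_mult, Cmod_pow, Cmod_1. lra.
Qed.

Lemma qpoch_neq0 (c q : C) (n : nat) :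
  (forall m, c * q ^ m <> 1) -> qpoch c q n <> 0.
Proof.
  intros H. induction n as [|n IH]; simpl.
  - apply C1_nz.
  - apply Cmult_neq_0; [exact IH | apply one_minus_neq0, H].
Qed.

(** The modulus of [1 - c * q ^ m] is squeezed between [1 - Cmod c * Cmod q ^ m] and
    [1 + Cmod c * Cmod q ^ m], so it tends to 1. Its inverse then converges too, and a convergent
    sequence is bounded. *)
Lemma inv_one_minus_geom_bounded (c q : C) :
  (Cmod q < 1)%R -> (forall m, c * q ^ m <> 1) ->
  exists M : R, (0 <= M)%R /\ forall m, (Cmod (/ (1 - c * q ^ m)) <= M)%R.
Proof.
  intros hq H.
  assert (G : forall t : R, is_lim_seq (fun m => 1 + t * Cmod q ^ m)%R 1).
  { intros t.
    replace (Finite 1) with (Finite (1 + t * 0)) by (f_equal; ring).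
    apply is_lim_seq_plus'; [apply is_lim_seq_const |].
    apply (is_lim_seq_scal_l _ _ 0), is_lim_seq_geom.
    rewrite Rabs_pos_eq; [exact hq | apply Cmod_ge_0]. }
  assert (L : is_lim_seq (fun m => Cmod (1 - c * q ^ m)) 1).
  { eapply is_lim_seq_le_le; [| exact (G (- Cmod c)%R) | exact (G (Cmod c))].
    intros m. simpl.
    assert (T1 := Cmod_triangle (1 - c * q ^ m) (c * q ^ m)).
    assert (T2 := Cmod_triangle 1 (- (c * q ^ m))).
    replace (1 - c * q ^ m + c * q ^ m) with (RtoC 1) in T1 by ring.
    rewrite Cmod_opp in T2. fold (1 - c * q ^ m) in T2.
    rewrite Cmod_1, Cmod_mult, Cmod_pow in T1, T2. lra. }
  apply is_lim_seq_inv in L; [| intros E; injection E; exact R1_neq_R0].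
  apply is_lim_seq_Reals in L.
  destruct (maj_by_pos _ (exist _ _ L)) as [M [HM B]].
  exists M. split; [lra |]. intros m. specialize (B m).
  rewrite Cmod_inv by apply one_minus_neq0, H.
  eapply Rle_trans; [apply Rle_abs | exact B].
Qed.

(** The successive ratios are [1 / (1 - t) = 1 + t / (1 - t)] with [t = c * q ^ j]. A uniform bound
    [M] on [1 / (1 - t)] puts them in the form required by [bounded_product], with constant
    [M * Cmod c]. *)
Lemma qpoch_inv_bounded (c q : C) :
  (Cmod q < 1)%R -> (forall m, c * q ^ m <> 1) ->
  exists M : R, forall n, (Cmod (/ qpoch c q n) <= M)%R.
Proof.
  intros hq H. destruct (inv_one_minus_geom_bounded c q hq H) as [M [HM B]].
  apply bounded_product with
    (fun j => / (1 - c * q ^ j)) (M * Cmod c)%R (Cmod q);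
    auto using Cmod_ge_0, Rmult_le_pos.
  - simpl. field.
  - intros j. simpl. field. split; [apply one_minus_neq0, H | now apply qpoch_neq0].
  - intros j.
    replace (/ (1 - c * q ^ j)) with (1 + / (1 - c * q ^ j) * (c * q ^ j))
      by (field; apply one_minus_neq0, H).
    eapply Rle_trans; [apply Cmod_triangle |].
    rewrite Cmod_1, !Cmod_mult, Cmod_pow, Rmult_assoc.
    apply Rplus_le_compat_l, Rmult_le_compat_r; [| apply B].
    apply Rmult_le_pos; [apply Cmod_ge_0 | apply pow_le, Cmod_ge_0].
Qed.

(** The definition splits off the last factor; splitting off the first one instead is what moves the
    parameter from [a] to [a * q]. *)
Lemma qpoch_succ (a q : C) (n : nat) :
  qpoch a q (S n) = (1 - a) * qpoch (a * q) q n.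
Proof.
  induction n as [|n IH].
  - simpl. ring.
  - change (qpoch a q (S (S n))) with (qpoch a q (S n) * (1 - a * q ^ S n)).
    rewrite IH, Cpow_S. simpl. ring.
Qed.

Lemma q_pow_neq1 (q : C) (m : nat) : (Cmod q < 1)%R -> q * q ^ m <> 1.
Proof.
  intros hq. apply Cmod_lt1_neq1. rewrite <- Cpow_S, Cmod_pow.
  apply pow_lt_1_compat; [split; [apply Cmod_ge_0 | exact hq] | lia].
Qed.

(** The three Humbert functions share this denominator and differ only in the numerator [A]. *)
Lemma humbert_coef_bounded (A : nat -> nat -> C) (c q : C) :
  (Cmod q < 1)%R -> (forall m, c * q ^ m <> 1) -> bounded_coef A ->
  bounded_coef (fun n k =>
    A n k / (qpoch c q (n + k) * qpoch q q n * qpoch q q k)).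
Proof.
  intros hq hc HA.
  assert (hqq : forall m, q * q ^ m <> 1) by (intros; now apply q_pow_neq1).
  destruct (qpoch_inv_bounded c q hq hc) as [M HM].
  destruct (qpoch_inv_bounded q q hq hqq) as [M' HM'].
  assert (H : bounded_coef (fun n k =>
    A n k * (/ qpoch c q (n + k) * (/ qpoch q q n * / qpoch q q k)))).
  { apply bounded_coef_mult; [exact HA |].
    apply bounded_coef_mult; [exists M; intros; apply HM |].
    apply bounded_coef_mult; exists M'; intros; apply HM'. }
  destruct H as [B HB]. exists B. intros n k.
  replace (A n k / _) with
    (A n k * (/ qpoch c q (n + k) * (/ qpoch q q n * / qpoch q q k)));
    [apply HB |].
  field. repeat split; now apply qpoch_neq0.
Qed.

(** * Powers of [q] and the admissibility condition *)

Lemma Cexp_plus (z w : C) : Cexp (z + w) = Cexp z * Cexp w.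
Proof.
  destruct z as [z1 z2], w as [w1 w2]. unfold Cexp; simpl.
  rewrite exp_plus, cos_plus, sin_plus.
  unfold Cmult, RtoC; simpl. f_equal; ring.
Qed.

Lemma qpow_succ (q lq z : C) : Cexp lq = q -> qpow lq (z + 1) = qpow lq z * q.
Proof.
  intros H. unfold qpow. rewrite <- H, <- Cexp_plus.
  f_equal. ring.
Qed.

(** Restates admissibility as the nonvanishing of every factor of [qpoch c q n]. *)
Lemma admissible_mult_pow_neq1 (q c : C) (m : nat) :
  q <> 0 -> admissible q c -> c * q ^ m <> 1.
Proof.
  intros hq H E. apply (H m).
  assert (N := Cpow_nz q m hq).
  replace c with (c * q ^ m / q ^ m) by (field; exact N).
  rewrite E. field. exact N.
Qed.

(** * The contiguous relations for [Phi1], [Phi2] and [Phi3] *)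

Theorem theorem2p6 (q lq : C) (hq0 : (0 < Cmod q)%R) (hq1 : (Cmod q < 1)%R)
    (hlq : Cexp lq = q) (alpha beta gamma x y : C)
    (hx : (Cmod x < 1)%R) (hy : (Cmod y < 1)%R) :
  (admissible q (qpow lq gamma) ->
    Theta_x q (Phi1 (qpow lq alpha) (qpow lq beta) (qpow lq gamma) q) x y
      = qnum q lq alpha * qnum q lq beta / qnum q lq gamma * x
        * Phi1 (qpow lq (alpha + 1)) (qpow lq (beta + 1))
            (qpow lq (gamma + 1)) q x y
    /\
    Theta_y q (Phi1 (qpow lq alpha) (qpow lq beta) (qpow lq gamma) q) x y
      = qnum q lq alpha / ((1 - q) * qnum q lq gamma) * y
        * Phi1 (qpow lq (alpha + 1)) (qpow lq beta)
            (qpow lq (gamma + 1)) q x y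
    /\
    Theta_x q (Phi2 (qpow lq alpha) (qpow lq beta) (qpow lq gamma) q) x y
      = qnum q lq alpha / ((1 - q) * qnum q lq gamma) * x
        * Phi2 (qpow lq (alpha + 1)) (qpow lq beta)
            (qpow lq (gamma + 1)) q x y
    /\
    Theta_y q (Phi2 (qpow lq alpha) (qpow lq beta) (qpow lq gamma) q) x y
      = qnum q lq beta / ((1 - q) * qnum q lq gamma) * y
        * Phi2 (qpow lq alpha) (qpow lq (beta + 1))
            (qpow lq (gamma + 1)) q x y)
  /\
  (admissible q (qpow lq beta) ->
    Theta_x q (Phi3 (qpow lq alpha) (qpow lq beta) q) x y
      = qnum q lq alpha / ((1 - q) * qnum q lq beta) * x
        * Phi3 (qpow lq (alpha + 1)) (qpow lq (beta + 1)) q x y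
    /\
    Theta_y q (Phi3 (qpow lq alpha) (qpow lq beta) q) x y
      = 1 / ((1 - q) ^ 2 * qnum q lq beta) * y
        * Phi3 (qpow lq alpha) (qpow lq (beta + 1)) q x y).
Proof.
  rewrite !(qpow_succ q lq _ hlq). unfold qnum.
  (* Once exponent shifts have become multiplications by [q], the three powers can be treated as
     arbitrary complex parameters. *)
  generalize (qpow lq alpha) (qpow lq beta) (qpow lq gamma).
  clear alpha beta gamma hlq lq. intros a b c.
  assert (hq : q <> 0) by (apply Cmod_gt_0; exact hq0).
  assert (h1q : 1 - q <> 0) by (apply one_minus_neq0, Cmod_lt1_neq1, hq1).
  assert (hqq : forall m, q * q ^ m <> 1) by (intros; now apply q_pow_neq1).
  (* The case [m = 0] makes the q-number in the denominator nonzero; the remaining cases say that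
     the shifted parameter [d * q] is admissible as well. *)
  assert (shift : forall d, (forall m, d * q ^ m <> 1) ->
    1 - d <> 0 /\ forall m, d * q * q ^ m <> 1).
  { intros d hd. split.
    - apply one_minus_neq0. intros E. apply (hd O). rewrite E. simpl. ring.
    - intros m. rewrite <- Cmult_assoc, <- Cpow_S. apply hd. }
  (* The map [i] stands for whichever of [n], [k] or [n + k] indexes the numerator factor. *)
  assert (bP : forall (d : C) (i : nat -> nat -> nat),
    bounded_coef (fun n k => qpoch d q (i n k))).
  { intros d i. destruct (qpoch_bounded d q hq1) as [M HM].
    exists M. intros; apply HM. }
  split.
  - intros hc0.
    assert (hc : forall m, c * q ^ m <> 1)
      by (intros; now apply admissible_mult_pow_neq1).
    destruct (shift c hc) as [h1c hcq].
    assert (nz : forall d n, (forall m, d * q ^ m <> 1) -> qpoch d q n <> 0)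
      by (intros; now apply qpoch_neq0).
    split; [| split; [| split]].
    + unfold Phi1. apply Theta_x_double_power_series; auto.
      1, 2: apply humbert_coef_bounded; auto;
        apply bounded_coef_mult; apply bP.
      (* Raising [n] shifts [a], [b] and [c] by splitting off first factors, while [qpoch q q (S n)]
         loses its last factor, which cancels [1 - q * q ^ n]. *)
      intros n k. change (S n + k)%nat with (S (n + k)).
      rewrite (qpoch_succ a), (qpoch_succ b), (qpoch_succ c).
      simpl qpoch. field. repeat split; auto using one_minus_neq0.
    + unfold Phi1. apply Theta_y_double_power_series; auto.
      1, 2: apply humbert_coef_bounded; auto;
        apply bounded_coef_mult; apply bP.
      (* Raising [k] affects only the factors indexed by [n + k], so [b] stays fixed. *)
      intros n k. rewrite <- plus_n_Sm.
      rewrite (qpoch_succ a), (qpoch_succ c).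
      simpl qpoch. field. repeat split; auto using one_minus_neq0.
    + unfold Phi2. apply Theta_x_double_power_series; auto.
      1, 2: apply humbert_coef_bounded; auto;
        apply bounded_coef_mult; apply bP.
      (* In [Phi2] the numerator indices are separate: raising [n] moves [a] and [c] only, raising
         [k] moves [b] and [c] only. *)
      intros n k. change (S n + k)%nat with (S (n + k)).
      rewrite (qpoch_succ a), (qpoch_succ c).
      simpl qpoch. field. repeat split; auto using one_minus_neq0.
    + unfold Phi2. apply Theta_y_double_power_series; auto.
      1, 2: apply humbert_coef_bounded; auto;
        apply bounded_coef_mult; apply bP.
      intros n k. rewrite <- plus_n_Sm.
      rewrite (qpoch_succ b), (qpoch_succ c).
      simpl qpoch. field. repeat split; auto using one_minus_neq0.
  - intros hb0.
    assert (hb : forall m, b * q ^ m <> 1)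
      by (intros; now apply admissible_mult_pow_neq1).
    destruct (shift b hb) as [h1b hbq].
    assert (nz : forall d n, (forall m, d * q ^ m <> 1) -> qpoch d q n <> 0)
      by (intros; now apply qpoch_neq0).
    split.
    + unfold Phi3. apply Theta_x_double_power_series; auto.
      1, 2: apply humbert_coef_bounded; auto; apply bP.
      intros n k. change (S n + k)%nat with (S (n + k)).
      rewrite (qpoch_succ a), (qpoch_succ b).
      simpl qpoch. field. repeat split; auto using one_minus_neq0.
    + unfold Phi3. apply Theta_y_double_power_series; auto.
      1, 2: apply humbert_coef_bounded; auto; apply bP.
      (* No numerator factor of [Phi3] depends on [k], so only the denominator parameter moves; this
         is why the constant has numerator 1. *)
      intros n k. rewrite <- plus_n_Sm.
      rewrite (qpoch_succ b).
      simpl qpoch. field. repeat split; auto using one_minus_neq0.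
Qed.
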